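(* Let $\alpha>0$, $A\ge0$, $B>0$, $t>0$, $w(x,t)=x^\alpha e^{-x}(A+B\theta(x-t))$ on $[0,\infty)$, $D_n(t)=\det\left(\int_0^\infty x^{i+j}w(x,t)dx\right)_{i,j=0}^{n-1}$, and $H_n(t):=t\frac{d}{dt}\ln D_n(t)$. Then for $n\ge1$ $$(tH_n'')^2=4(H_n')^2\left[H_n-n(n+\alpha)-tH_n'\right]+\left[(2n+\alpha-t)H_n'+H_n\right]^2.$$
   Context: $\theta$ is the Heaviside function ($1$ for $x>0$, $0$ otherwise); primes denote $d/dt$. *)

(* Defs.v *)
From Stdlib Require Import Reals.
From Coquelicot Require Import Coquelicot.
From mathcomp Require Import all_boot all_algebra.
From mathcomp Require Import Rstruct.

Open Scope R_scope.

Definition theta (x : R) : R := if Rlt_dec 0 x then 1 else 0.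

Definition weight (alpha A B t x : R) : R :=
  Rpower x alpha * exp (- x) * (A + B * theta (x - t)).

Definition moment (alpha A B : R) (k : nat) (t : R) : R :=
  RInt_gen (fun x => x ^ k * weight alpha A B t x)
           (at_point 0) (Rbar_locally p_infty).

Definition Dn (alpha A B : R) (n : nat) (t : R) : R :=
  (\det (\matrix_(i < n, j < n) moment alpha A B (i + j)%N t))%R.

Definition Hn (alpha A B : R) (n : nat) (t : R) : R :=
  t * Derive (fun s => ln (Dn alpha A B n s)) t.

(* Main.v *)
Require Import Defs.
From Stdlib Require Import Reals Lra.
From Coquelicot Require Import Coquelicot.
From mathcomp Require all_boot all_order all_algebra perm Rstruct.
Open Scope R_scope.

(* Substituting x = t y in the moments turns D_n(t) into t^(n(n+alpha)) tau_n(t), where tau_n is the Hankel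
   determinant of moments nu_k with nu_k' = - nu_(k+1).  Hence tau_n satisfies the Toda equation
   tau_n tau_n'' - tau_n'^2 = tau_(n-1) tau_(n+1) (Jacobi's identity for minors).  Let p_n = (ln tau_n)',
   beta_n = p_n', a_n = p_n - p_(n+1), and let P_n be the value at the jump of the monic polynomials with
   recurrence coefficients a_n, beta_n, so that P_n' = beta_n P_(n-1).  With w_n = B e^(-t) tau_n / tau_(n+1),
   u_n = w_n P_n^2 and v_n = w_n P_n P_n', one has
     t a_n = 2n + 1 + alpha + u_n   and   p_n + t beta_n = v_n :
   for n = 0 this is integration by parts; differentiating the first relation gives the second at n + 1, and
   differentiating that one gives the first at n + 1.  Summing over n,
     t (beta_n u_n + w_n P_n'^2) + (2n + alpha) v_n + n (n + alpha) - t^2 beta_n = 0.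
   Finally H_n = n (n + alpha) + t p_n, H_n' = v_n and H_n'' = w_n P_n'^2 - beta_n u_n, so the claim is
   (X + Y)^2 - (X - Y)^2 = 4 X Y with X = t beta_n u_n and Y = t w_n P_n'^2. *)

(** * Differentiating identities that hold on a half-line *)

Lemma is_derive_ext_gt (f g : R -> R) (a s l : R) :
  a < s -> (forall x, a < x -> f x = g x) -> is_derive f s l -> is_derive g s l.
Proof.
intros Has E; apply is_derive_ext_loc.
apply filter_imp with (1 := E), (open_gt a s Has).
Qed.

(** This is the tool for differentiating an identity known for all positive arguments. *)
Lemma is_derive_local_eq (f g : R -> R) (s l m : R) :
  0 < s -> (forall x, 0 < x -> f x = g x) ->
  is_derive f s l -> is_derive g s m -> l = m.
Proof.
intros Hs E Hf Hg.
rewrite <- (is_derive_unique _ _ _ (is_derive_ext_gt _ _ 0 s l Hs E Hf)).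
now apply is_derive_unique.
Qed.

(** [auto_derive] leaves [Derive] of abstract functions in its goals; this replaces them by their
    known values. *)
Ltac derive_rw D :=
  match type of D with
  | is_derive ?f ?s ?l =>
      replace (Derive (fun x : R => f x) s) with l
        by (symmetry; exact (is_derive_unique f s l D))
  end.

(** * From the Toda equation to the sigma form *)

Section Toda.

Variables (alpha B : R) (tau dtau ddtau : nat -> R -> R).
Hypothesis tau_pos : forall n s, 0 < s -> 0 < tau n s.
Hypothesis tau0 : forall s, 0 < s -> tau 0%nat s = 1.
Hypothesis tau_derive : forall n s, 0 < s -> is_derive (tau n) s (dtau n s).
Hypothesis dtau_derive : forall n s, 0 < s -> is_derive (dtau n) s (ddtau n s).
Hypothesis toda : forall n s, 0 < s ->
  tau n s * tau (S (S n)) s = tau (S n) s * ddtau (S n) s - dtau (S n) s ^ 2.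
Hypothesis base : forall s, 0 < s ->
  - (s * dtau 1%nat s) = (1 + alpha) * tau 1%nat s + B * exp (- s).

(* When tau is the Hankel determinant of a weight, beta and diag are the coefficients beta_n and a_n of the
   three-term recurrence of its monic orthogonal polynomials, and op_jumps pairs P_n with P_n'. *)
Definition dlog n s := dtau n s / tau n s.
Definition beta n s :=
  match n with O => 0 | S m => tau m s * tau (S (S m)) s / tau (S m) s ^ 2 end.
Arguments beta : simpl never.

Lemma beta_0 s : beta 0 s = 0.
Proof. reflexivity. Qed.

Lemma beta_S n s : beta (S n) s = tau n s * tau (S (S n)) s / tau (S n) s ^ 2.
Proof. reflexivity. Qed.

Definition diag n s := dlog n s - dlog (S n) s.
(** For a Hankel determinant, h_n = tau_(n+1) / tau_n is the squared norm of P_n, and B e^(-s) is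
    the jump of the rescaled weight, so this is jump / h_n. *)
Definition jump_w n s := B * exp (- s) * tau n s / tau (S n) s.

Fixpoint op_jumps n s : R * R :=
  match n with
  | O => (1, 0)
  | S m => ((1 - diag m s) * fst (op_jumps m s) - snd (op_jumps m s),
            beta (S m) s * fst (op_jumps m s))
  end.
Definition op_jump n s := fst (op_jumps n s).
Definition op_jump_d n s := snd (op_jumps n s).

Lemma op_jump_S n s : op_jump (S n) s = (1 - diag n s) * op_jump n s - op_jump_d n s.
Proof. reflexivity. Qed.
Lemma op_jump_d_S n s : op_jump_d (S n) s = beta (S n) s * op_jump n s.
Proof. reflexivity. Qed.

Let tau_neq n s (Hs : 0 < s) : tau n s <> 0 := Rgt_not_eq _ _ (tau_pos n s Hs).

Lemma dtau0 s : 0 < s -> dtau 0%nat s = 0.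
Proof.
intros Hs; apply (is_derive_local_eq (tau 0%nat) (fun _ => 1) s); auto.
apply (is_derive_const (V := R_NormedModule)).
Qed.

Lemma ddtau0 s : 0 < s -> ddtau 0%nat s = 0.
Proof.
intros Hs; apply (is_derive_local_eq (dtau 0%nat) (fun _ => 0) s); auto using dtau0.
apply (is_derive_const (V := R_NormedModule)).
Qed.

Lemma dlog_derive n s : 0 < s -> is_derive (dlog n) s (beta n s).
Proof.
intros Hs; unfold dlog.
evar (l : R); replace (beta n s) with l; subst l.
- apply is_derive_div; [now apply dtau_derive | now apply tau_derive | now apply tau_neq].
- destruct n as [|n].
  + rewrite beta_0, ddtau0, dtau0 by easy. field. now apply tau_neq.
  + rewrite beta_S, toda by easy. field. now apply tau_neq.
Qed.

(** Logarithmic differentiation: p_n + p_(n+2) - 2 p_(n+1) = a_n - a_(n+1). *)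
Lemma beta_derive n s : 0 < s ->
  is_derive (beta (S n)) s (beta (S n) s * (diag n s - diag (S n) s)).
Proof.
intros Hs.
change (is_derive (fun s => tau n s * tau (S (S n)) s / tau (S n) s ^ 2) s
  (beta (S n) s * (diag n s - diag (S n) s))).
generalize (tau_derive n s Hs), (tau_derive (S n) s Hs), (tau_derive (S (S n)) s Hs); intros D0 D1 D2.
generalize (tau_neq n s Hs), (tau_neq (S n) s Hs), (tau_neq (S (S n)) s Hs); intros N0 N1 N2.
auto_derive.
- repeat split; try (eexists; eassumption).
  apply Rmult_integral_contrapositive_currified; [easy|]. now rewrite Rmult_1_r.
- derive_rw D0; derive_rw D1; derive_rw D2.
  unfold diag, dlog; rewrite beta_S. field. auto.
Qed.

Lemma diag_derive n s : 0 < s -> is_derive (diag n) s (beta n s - beta (S n) s).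
Proof.
intros Hs. apply (is_derive_minus (V := R_NormedModule)); now apply dlog_derive.
Qed.

Lemma jump_w_derive n s : 0 < s -> is_derive (jump_w n) s (jump_w n s * (diag n s - 1)).
Proof.
intros Hs.
change (is_derive (fun s => B * exp (- s) * tau n s / tau (S n) s) s
  (jump_w n s * (diag n s - 1))).
generalize (tau_derive n s Hs), (tau_derive (S n) s Hs); intros D0 D1.
generalize (tau_neq n s Hs), (tau_neq (S n) s Hs); intros N0 N1.
auto_derive.
- repeat split; try (eexists; eassumption). easy.
- derive_rw D0; derive_rw D1.
  unfold jump_w, diag, dlog. field. auto.
Qed.

(** In terms of the norms, beta_(n+1) = h_(n+1) / h_n. *)
Lemma jump_w_beta n s : 0 < s -> jump_w n s = jump_w (S n) s * beta (S n) s.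
Proof.
intros Hs; unfold jump_w; rewrite beta_S. field. repeat split; now apply tau_neq.
Qed.

(** The three-term recurrence, taken at the point 1 where the rescaled weight jumps, is
    differentiated. It involves two consecutive P_n, so the induction carries both derivatives. All
    terms but beta_(n+2) P_(n+1) cancel by the recurrence one index lower. *)
Lemma op_jumps_derive n s : 0 < s ->
  is_derive (op_jump n) s (op_jump_d n s) /\
  is_derive (fun x => (1 - diag n x) * op_jump n x - op_jump_d n x) s (op_jump_d (S n) s).
Proof.
intros Hs; induction n as [|n [IH1 IH2]].
- split; [exact (is_derive_const (V := R_NormedModule) 1 s)|].
  change (is_derive (fun x => (1 - diag 0%nat x) * 1 - 0) s (beta 1%nat s * 1)).
  generalize (diag_derive 0 s Hs); intros D.
  auto_derive; [eexists; eassumption|].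
  derive_rw D. rewrite beta_0. ring.
- split; [exact IH2|].
  generalize (diag_derive (S n) s Hs); intros D.
  generalize (beta_derive n s Hs); intros Db.
  rewrite op_jump_d_S, op_jump_S.
  apply is_derive_ext with
    (fun x => (1 - diag (S n) x) * op_jump (S n) x - beta (S n) x * op_jump n x); [easy|].
  assert (D1 : is_derive (op_jump (S n)) s (op_jump_d (S n) s)) by exact IH2.
  auto_derive; [repeat split; eexists; eassumption|].
  derive_rw D; derive_rw Db; derive_rw D1; derive_rw IH1. rewrite op_jump_S, op_jump_d_S.
  ring.
Qed.

Lemma op_jump_derive n s : 0 < s -> is_derive (op_jump n) s (op_jump_d n s).
Proof. intros Hs; now apply op_jumps_derive. Qed.

(** [ladder_u] is jump * P_n^2 / h_n, and for n >= 1 [ladder_v] is jump * P_n P_(n-1) / h_(n-1): the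
    auxiliary quantities of the ladder operators for a weight with a jump. *)
Definition ladder_u n s := jump_w n s * op_jump n s ^ 2.
Definition ladder_v n s := jump_w n s * op_jump n s * op_jump_d n s.

Lemma ladder_v_S n s : 0 < s -> ladder_v (S n) s = jump_w n s * op_jump n s * op_jump (S n) s.
Proof. intros Hs; unfold ladder_v; rewrite op_jump_d_S, (jump_w_beta n s Hs). ring. Qed.

(** The recurrence turns (a_n - 1) P_n + P_n' into - P_(n+1). The resulting difference has the same
    shape as a_n' = beta_n - beta_(n+1). *)
Lemma ladder_u_derive n s : 0 < s -> is_derive (ladder_u n) s (ladder_v n s - ladder_v (S n) s).
Proof.
intros Hs; unfold ladder_u.
generalize (jump_w_derive n s Hs), (op_jump_derive n s Hs); intros Dj Dq.
auto_derive; [repeat split; eexists; eassumption|].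
derive_rw Dj; derive_rw Dq. rewrite ladder_v_S by easy.
unfold ladder_v; rewrite op_jump_S; ring.
Qed.

Lemma ladder_v_derive n s : 0 < s ->
  is_derive (ladder_v n) s (jump_w n s * op_jump_d n s ^ 2 - beta n s * ladder_u n s).
Proof.
intros Hs; destruct n as [|n].
- apply is_derive_ext with (fun _ => 0).
    intros x; unfold ladder_v, op_jump_d; simpl; ring.
  replace (_ - _) with 0; [apply (is_derive_const (V := R_NormedModule))|].
  rewrite beta_0; unfold op_jump_d; simpl; ring.
(* With w_n in place of w_(n+1), v_(n+1) = w_n P_n P_(n+1) is a product of functions whose
   derivatives are known. *)
- replace (_ - _) with (jump_w n s * (op_jump_d (S n) s * op_jump n s - op_jump (S n) s ^ 2)).
    2: unfold ladder_u; rewrite op_jump_d_S, (jump_w_beta n s Hs); ring.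
  generalize (jump_w_derive n s Hs), (op_jump_derive n s Hs), (op_jump_derive (S n) s Hs); intros Dj Dq D1.
  apply is_derive_ext_gt with (fun s => jump_w n s * op_jump n s * op_jump (S n) s) 0;
    [easy | intros x Hx; now rewrite ladder_v_S |].
  auto_derive; [repeat split; eexists; eassumption|].
  derive_rw Dj; derive_rw Dq; derive_rw D1.
  rewrite !op_jump_S; ring.
Qed.

Lemma ladder n :
  (forall s, 0 < s -> s * diag n s - ladder_u n s = 2 * INR n + 1 + alpha) /\
  (forall s, 0 < s -> dlog n s + s * beta n s = ladder_v n s).
Proof.
induction n as [|n [IH1 IH2]].
- split; intros s Hs.
  (* Here P_0 = 1 and p_0 = 0, so the claim is [base] divided by tau_1. *)
  + unfold diag, ladder_u, jump_w, op_jump, dlog; simpl. rewrite tau0, dtau0 by easy.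
    generalize (base s Hs) (tau_neq 1 s Hs); intros E N.
    apply (Rmult_eq_reg_r (tau 1 s)); [|easy].
    field_simplify; [|easy]. lra.
  + rewrite beta_0; unfold dlog, ladder_v, op_jump_d; simpl; rewrite dtau0 by easy. field; now apply tau_neq.
- assert (E2 : forall s, 0 < s -> dlog (S n) s + s * beta (S n) s = ladder_v (S n) s).
  { intros s Hs.
    generalize (diag_derive n s Hs), (ladder_u_derive n s Hs); intros Da Du.
    (* The derivative of the constant s a_n - u_n is the difference of the second relation at n and
       at n + 1. *)
    assert (E : diag n s + s * (beta n s - beta (S n) s) - (ladder_v n s - ladder_v (S n) s) = 0).
    { apply (is_derive_local_eq (fun s => s * diag n s - ladder_u n s)
        (fun _ => 2 * INR n + 1 + alpha) s); auto.
      - auto_derive; [repeat split; eexists; eassumption|].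
        derive_rw Da; derive_rw Du. ring.
      - apply (is_derive_const (V := R_NormedModule)). }
    generalize (IH2 s Hs); unfold diag in E; lra. }
  split; [|exact E2].
  intros s Hs.
  generalize (dlog_derive (S n) s Hs), (beta_derive n s Hs), (ladder_v_derive (S n) s Hs); intros Dp Db Dv.
  replace (jump_w (S n) s * op_jump_d (S n) s ^ 2 - beta (S n) s * ladder_u (S n) s)
    with (beta (S n) s * (ladder_u n s - ladder_u (S n) s)) in Dv
    by (unfold ladder_u; rewrite op_jump_d_S, (jump_w_beta n s Hs); ring).
  assert (E : 2 * beta (S n) s + s * (beta (S n) s * (diag n s - diag (S n) s))
              = beta (S n) s * (ladder_u n s - ladder_u (S n) s)).
  { apply (is_derive_local_eq (fun s => dlog (S n) s + s * beta (S n) s) (ladder_v (S n)) s); auto.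
    auto_derive; [repeat split; eexists; eassumption|].
    derive_rw Dp; derive_rw Db. ring. }
  (* The differentiated second relation has the factor beta_(n+1), which is positive; cancelling it
     leaves the difference of the first relation at n and n + 1. *)
  assert (F : beta (S n) s * (2 + s * (diag n s - diag (S n) s) - (ladder_u n s - ladder_u (S n) s)) = 0)
    by (rewrite Rmult_minus_distr_l, <- E; ring).
  apply Rmult_integral in F; destruct F as [F|F].
  + exfalso; revert F; rewrite beta_S; apply Rgt_not_eq.
    apply Rdiv_lt_0_compat; [apply Rmult_lt_0_compat|apply pow_lt]; now apply tau_pos.
  + rewrite S_INR; generalize (IH1 s Hs); lra.
Qed.

Lemma sum_rule n s : 0 < s ->
  s * (beta n s * ladder_u n s + jump_w n s * op_jump_d n s ^ 2)
  + (2 * INR n + alpha) * ladder_v n s + INR n * (INR n + alpha) - s ^ 2 * beta n s = 0.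
Proof.
intros Hs; induction n as [|n IH].
- rewrite beta_0; unfold ladder_v, op_jump_d; simpl; ring.
- destruct (ladder n) as [La Lv]; destruct (ladder (S n)) as [_ Lw].
  specialize (La s Hs); specialize (Lv s Hs); specialize (Lw s Hs).
  assert (E : beta (S n) s * ladder_u (S n) s = jump_w n s * op_jump (S n) s ^ 2)
    by (unfold ladder_u; rewrite (jump_w_beta n s Hs); ring).
  assert (E' : jump_w (S n) s * op_jump_d (S n) s ^ 2 = beta (S n) s * ladder_u n s)
    by (unfold ladder_u; rewrite op_jump_d_S, (jump_w_beta n s Hs); ring).
  rewrite E, E', S_INR.
  set (b1 := beta (S n) s) in *.
  assert (Eb : s * b1 = ladder_v (S n) s - dlog (S n) s) by lra.
  (* The ladder relations now eliminate s beta_(n+1), the p_n and finally n itself; what remains is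
     an identity between rational expressions in s, alpha, a_n, beta_n, w_n, P_n and P_n'. *)
  rewrite <- IH.
  replace (s ^ 2 * b1) with (s * (s * b1)) by ring.
  replace (s * (jump_w n s * op_jump (S n) s ^ 2 + b1 * ladder_u n s)) with
    (s * (jump_w n s * op_jump (S n) s ^ 2) + (s * b1) * ladder_u n s) by ring.
  replace (dlog (S n) s) with (dlog n s - diag n s) in Eb by (unfold diag; ring).
  replace (dlog n s) with (ladder_v n s - s * beta n s) in Eb by lra.
  rewrite Eb.
  replace (INR n) with ((s * diag n s - ladder_u n s - 1 - alpha) / 2) by lra.
  rewrite ladder_v_S by easy. unfold ladder_u, ladder_v. rewrite op_jump_S. field.
Qed.

Lemma sigma_form (H : R -> R) n t : 0 < t ->
  (forall s, 0 < s -> H s = INR n * (INR n + alpha) + s * dlog n s) ->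
  let H1 := Derive H t in
  let H2 := Derive (Derive H) t in
  (t * H2) ^ 2 =
    4 * H1 ^ 2 * (H t - INR n * (INR n + alpha) - t * H1)
    + ((2 * INR n + alpha - t) * H1 + H t) ^ 2.
Proof.
intros Ht EH H1 H2.
assert (D1 : forall s, 0 < s -> Derive H s = ladder_v n s).
{ intros s Hs; apply is_derive_unique.
  apply is_derive_ext_gt with (fun s => INR n * (INR n + alpha) + s * dlog n s) 0; [easy| |].
  - intros x Hx; now rewrite EH.
  - assert (D := dlog_derive n s Hs).
    rewrite <- (proj2 (ladder n)) by easy.
    auto_derive; [repeat split; eexists; eassumption|]. derive_rw D; ring. }
assert (E2 : H2 = jump_w n t * op_jump_d n t ^ 2 - beta n t * ladder_u n t).
{ apply is_derive_unique.
  apply is_derive_ext_gt with (ladder_v n) 0; [easy| |now apply ladder_v_derive].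
  intros x Hx; now rewrite D1. }
unfold H1; rewrite E2, (D1 t Ht), (EH t Ht).
assert (E := proj2 (ladder n) t Ht); assert (S := sum_rule n t Ht).
replace (dlog n t) with (ladder_v n t - t * beta n t) by lra.
(* The sum rule makes this term -(X + Y), and the bracket H - n (n + alpha) - t H' equals -t^2
   beta_n, so that 4 v_n^2 times it is -4 X Y. *)
replace ((2 * INR n + alpha - t) * ladder_v n t
    + (INR n * (INR n + alpha) + t * (ladder_v n t - t * beta n t)))
  with (- (t * (beta n t * ladder_u n t + jump_w n t * op_jump_d n t ^ 2))) by lra.
unfold ladder_v, ladder_u; ring.
Qed.

End Toda.

(** * Incomplete and complete gamma integrals *)

Definition gam (e x : R) : R := if Rle_dec x 0 then 0 else Rpower x e * exp (- x).

Lemma gam_pos e x : 0 < x -> gam e x = Rpower x e * exp (- x).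
Proof. intros Hx; unfold gam; destruct (Rle_dec x 0); [lra|easy]. Qed.

Lemma gam_neg e x : x <= 0 -> gam e x = 0.
Proof. intros Hx; unfold gam; destruct (Rle_dec x 0); [easy|lra]. Qed.

Lemma gam_ge0 e x : 0 <= gam e x.
Proof.
unfold gam; destruct (Rle_dec x 0); [lra|].
apply Rmult_le_pos; apply Rlt_le, exp_pos.
Qed.

Lemma gam_pow e k x : gam (e + INR k) x = x ^ k * gam e x.
Proof.
destruct (Rle_dec x 0) as [Hx|Hx].
- rewrite !gam_neg by easy; ring.
- apply Rnot_le_lt in Hx. rewrite !gam_pos, Rpower_plus, Rpower_pow by easy. ring.
Qed.

Lemma gam_derive e x : 0 < x -> is_derive (gam e) x (e / x * gam e x - gam e x).
Proof.
intros Hx.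
apply is_derive_ext_gt with (fun y => exp (e * ln y) * exp (- y)) 0;
  [easy | intros y Hy; now rewrite gam_pos |].
rewrite gam_pos by easy. unfold Rpower. auto_derive; [easy|]. field. lra.
Qed.

(** Continuity at 0 is the reason for the cut-off in [gam]: [Rpower x e] equals 1 for x <= 0,
    because [ln] is 0 there. *)
Lemma gam_continuous e x : 0 < e -> continuous (gam e) x.
Proof.
intros He.
destruct (Rtotal_order x 0) as [Hx|[->|Hx]].
- apply continuous_ext_loc with (fun _ => 0); [|apply continuous_const].
  apply filter_imp with (2 := open_lt 0 x Hx); intros y Hy.
  rewrite gam_neg by lra; easy.
- apply filterlim_locally; intros eps.
  (* For 0 < y < eps^(1/e) one has y^e < eps. *)
  assert (Hd : 0 < Rpower eps (/ e)) by apply exp_pos.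
  exists (mkposreal _ Hd); intros y Hy.
  change (Rabs (gam e y - gam e 0) < eps).
  apply Rabs_def2 in Hy; simpl in Hy; unfold minus, plus, opp in Hy; simpl in Hy.
  rewrite (gam_neg e 0), Rminus_0_r, Rabs_pos_eq by (lra || apply gam_ge0).
  destruct (Rle_dec y 0) as [Hy0|Hy0]; [rewrite gam_neg by easy; apply cond_pos|].
  apply Rnot_le_lt in Hy0. rewrite gam_pos by easy.
  apply Rlt_le_trans with (Rpower eps (/ e * e) * 1).
  + apply Rmult_gt_0_lt_compat; try apply exp_pos; try lra.
    * rewrite <- Rpower_mult. apply Rlt_Rpower_l; lra.
    * rewrite <- exp_0; apply exp_increasing; lra.
  + rewrite Rinv_l, Rpower_1 by (lra || apply cond_pos); lra.
- apply (ex_derive_continuous (V := R_NormedModule)).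
  eexists; now apply gam_derive.
Qed.

(** For b >= 0 this is the lower incomplete gamma function at parameter e + 1. *)
Definition Gam (e b : R) : R := RInt (gam e) 0 b.

Lemma ex_RInt_gam e a b : 0 < e -> ex_RInt (gam e) a b.
Proof.
intros He; apply (ex_RInt_continuous (V := R_CompleteNormedModule)); intros.
now apply gam_continuous.
Qed.

Lemma Gam_derive e b : 0 < e -> is_derive (Gam e) b (gam e b).
Proof.
intros He; apply (is_derive_RInt (V := R_NormedModule) (gam e) _ 0).
- exists (mkposreal 1 Rlt_0_1); intros y _.
  apply (RInt_correct (V := R_CompleteNormedModule)); now apply ex_RInt_gam.
- now apply gam_continuous.
Qed.

Lemma Gam0 e : Gam e 0 = 0.
Proof. apply (RInt_point (V := R_CompleteNormedModule)). Qed.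

Lemma derive_ge0_incr (f df : R -> R) a b :
  (forall x, a <= x <= b -> is_derive f x (df x)) ->
  (forall x, a <= x <= b -> 0 <= df x) -> a <= b -> f a <= f b.
Proof.
intros D P Hab.
destruct (MVT_gen f a b df) as [c [Hc E]].
- intros x Hx; rewrite Rmin_left, Rmax_right in Hx by easy; apply D; lra.
- intros x Hx; rewrite Rmin_left, Rmax_right in Hx by easy.
  apply continuity_pt_filterlim, (ex_derive_continuous (V := R_NormedModule)).
  exists (df x); apply D; lra.
- rewrite Rmin_left, Rmax_right in Hc by easy.
  assert (0 <= df c * (b - a)) by (apply Rmult_le_pos; [now apply P|lra]). lra.
Qed.

Lemma Gam_incr e a b : 0 < e -> a <= b -> Gam e a <= Gam e b.
Proof.
intros He; apply derive_ge0_incr with (gam e); intros x _;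
  [now apply Gam_derive | apply gam_ge0].
Qed.

(** Half of the exponential absorbs the power: ln z <= z - 1 at z = x / (2 e) gives e ln x <= e ln
    (2 e) + x / 2 - e. *)
Lemma gam_le e x : 0 < e -> gam e x <= exp (e * ln (2 * e)) * exp (- (x / 2)).
Proof.
intros He; destruct (Rle_dec x 0) as [Hx|Hx].
- rewrite gam_neg by easy; apply Rmult_le_pos; apply Rlt_le, exp_pos.
- apply Rnot_le_lt in Hx; rewrite gam_pos by easy; unfold Rpower.
  rewrite <- !exp_plus.
  assert (L : ln x <= ln (2 * e) + (x / (2 * e) - 1)).
  { replace x with ((2 * e) * (x / (2 * e))) at 1 by (field; lra).
    assert (0 < x / (2 * e)) by (apply Rdiv_lt_0_compat; lra).
    rewrite ln_mult by lra.
    generalize (exp_ineq1_le (ln (x / (2 * e)))); rewrite exp_ln by easy; lra. }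
  apply Rmult_le_compat_l with (r := e) in L; [|lra].
  replace (e * (ln (2 * e) + (x / (2 * e) - 1))) with (e * ln (2 * e) + x / 2 - e) in L by (field; lra).
  assert (E : e * ln x + - x <= e * ln (2 * e) + - (x / 2)) by lra.
  destruct E as [E|E]; [left; now apply exp_increasing | right; now rewrite E].
Qed.

Lemma Gam_bound e b : 0 < e -> 0 <= b -> Gam e b <= 2 * exp (e * ln (2 * e)).
Proof.
intros He Hb.
set (C := exp (e * ln (2 * e))).
assert (E : 2 * C - 2 * C * exp (- (0 / 2)) - Gam e 0 <= 2 * C - 2 * C * exp (- (b / 2)) - Gam e b).
(* The integral from 0 to b of the bound in [gam_le] is 2 C - 2 C exp (- b / 2). *)
{ apply (derive_ge0_incr (fun b => 2 * C - 2 * C * exp (- (b / 2)) - Gam e b)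
    (fun x => C * exp (- (x / 2)) - gam e x)); [| |easy].
  - intros x _. generalize (Gam_derive e x He); intros D.
    auto_derive; [eexists; eassumption|].
    replace (Derive (fun x => Gam e x) x) with (gam e x) by (symmetry; exact (is_derive_unique _ _ _ D)).
    unfold Rdiv; field.
  - intros x _. generalize (gam_le e x He); fold C; lra. }
rewrite Gam0 in E. replace (- (0 / 2)) with 0 in E by field. rewrite exp_0 in E.
assert (0 < C * exp (- (b / 2))) by (apply Rmult_lt_0_compat; apply exp_pos). lra.
Qed.

(** A bounded nondecreasing function converges to its supremum. *)
Lemma Gam_lim e : 0 < e -> exists L : R, is_lim (Gam e) p_infty L.
Proof.
intros He.
destruct (completeness (fun y => exists b, 0 <= b /\ y = Gam e b)) as [L [HL1 HL2]].
- exists (2 * exp (e * ln (2 * e))); intros y [b [Hb ->]]; now apply Gam_bound.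
- exists (Gam e 0), 0; split; [lra|easy].
- exists L; apply is_lim_spec; intros eps; simpl.
  assert (H : exists b, 0 <= b /\ L - eps < Gam e b).
  { apply Classical_Prop.NNPP; intros N.
    assert (L <= L - eps); [|generalize (cond_pos eps); lra].
    apply HL2; intros y [b [Hb ->]].
    apply Rnot_lt_le; intros Hlt; apply N; now exists b. }
  destruct H as [b [Hb H]]; exists b; intros x Hx.
  assert (Gam e x <= L) by (apply HL1; exists x; split; [lra|easy]).
  generalize (Gam_incr e b x He (Rlt_le _ _ Hx)) (cond_pos eps); intros.
  apply Rabs_def1; lra.
Qed.

(** For e > 0 this is Euler's Gamma at e + 1. *)
Definition Gam_inf (e : R) : R := real (Lim (Gam e) p_infty).

Lemma Gam_inf_lim e : 0 < e -> is_lim (Gam e) p_infty (Gam_inf e).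
Proof.
intros He; destruct (Gam_lim e He) as [L HL].
unfold Gam_inf; now rewrite (is_lim_unique _ _ _ HL).
Qed.

Lemma is_lim_gam e : 0 < e -> is_lim (gam e) p_infty 0.
Proof.
intros He.
apply is_lim_le_le_loc with (fun _ => 0) (fun x => exp (e * ln (2 * e)) * exp (- (x / 2))).
- exists 0; intros x _; split; [apply gam_ge0 | now apply gam_le].
- apply is_lim_const.
- replace (Finite 0) with (Rbar_mult (exp (e * ln (2 * e))) 0) by (simpl; f_equal; ring).
  apply is_lim_scal_l.
  apply is_lim_comp with m_infty; [apply is_lim_exp_m| |exists 0; easy].
  apply is_lim_ext with (fun x => (- / 2) * x); [intros; field|].
  replace m_infty with (Rbar_mult (- / 2) p_infty).
  + apply is_lim_scal_l, is_lim_id.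
  + simpl. destruct (Rle_dec 0 (- / 2)); [exfalso; lra|easy].
Qed.

(** Integration by parts in differential form: the difference of the two sides is continuous,
    vanishes at 0 and has zero derivative on (0, b). *)
Lemma Gam_rec e b : 0 < e -> 0 <= b -> Gam (e + 1) b = (e + 1) * Gam e b - gam (e + 1) b.
Proof.
intros He Hb.
destruct (MVT_gen (fun b => Gam (e + 1) b - (e + 1) * Gam e b + gam (e + 1) b) 0 b (fun _ => 0)) as [c [_ E]].
- intros x Hx; rewrite Rmin_left in Hx by easy.
  assert (D1 := Gam_derive (e + 1) x ltac:(lra)).
  assert (D2 := Gam_derive e x He).
  assert (D3 := gam_derive (e + 1) x (proj1 Hx)).
  evar (l : R); replace 0 with l; subst l.
  + apply (is_derive_plus (V := R_NormedModule)); [|exact D3].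
    apply (is_derive_minus (V := R_NormedModule)); [exact D1|].
    apply (is_derive_scal (Gam e) x (e + 1) _ D2).
  + assert (P := gam_pow e 1 x); simpl INR in P. rewrite !P.
    unfold plus, minus, plus, opp; simpl. field. lra.
- intros x _. apply continuity_pt_filterlim.
  assert (CG : forall d, 0 < d -> continuous (Gam d) x).
  { intros d Hd; apply (ex_derive_continuous (V := R_NormedModule)).
    exists (gam d x); now apply Gam_derive. }
  apply (continuous_plus (V := R_NormedModule) (fun b => Gam (e + 1) b - (e + 1) * Gam e b)).
  + apply (continuous_minus (V := R_NormedModule) (Gam (e + 1)) (fun b => (e + 1) * Gam e b)).
    * apply CG; lra.
    * apply (continuous_scal_r (V := R_NormedModule) (e + 1) (Gam e)). now apply CG.
  + apply gam_continuous; lra.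
- rewrite !Gam0, (gam_neg _ 0) in E by lra. lra.
Qed.

Lemma Gam_inf_rec e : 0 < e -> Gam_inf (e + 1) = (e + 1) * Gam_inf e.
Proof.
intros He.
assert (L1 := Gam_inf_lim (e + 1) ltac:(lra)).
assert (L : is_lim (fun b => (e + 1) * Gam e b - gam (e + 1) b) p_infty ((e + 1) * Gam_inf e - 0)).
{ apply is_lim_minus'; [|apply is_lim_gam; lra].
  exact (is_lim_scal_l (Gam e) (e + 1) p_infty (Gam_inf e) (Gam_inf_lim e He)). }
assert (L2 : is_lim (Gam (e + 1)) p_infty ((e + 1) * Gam_inf e - 0)).
{ apply is_lim_ext_loc with (2 := L). exists 0; intros x Hx; rewrite Gam_rec; lra. }
apply is_lim_unique in L1; apply is_lim_unique in L2.
rewrite L1 in L2; injection L2; lra.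
Qed.

(** * The moments as gamma integrals *)

Section Moments.

Variables (alpha A B : R).
Hypothesis alpha_pos : 0 < alpha.

Let ek k : 0 < alpha + INR k := Rplus_lt_le_0_compat _ _ alpha_pos (pos_INR k).

(** The integrand is A times [gam] before t and A + B times [gam] after it. *)
Lemma moment_eq k t : 0 < t ->
  moment alpha A B k t = (A + B) * Gam_inf (alpha + INR k) - B * Gam (alpha + INR k) t.
Proof.
intros Ht; set (e := alpha + INR k).
apply (is_RInt_gen_unique (V := R_CompleteNormedModule)); intros P HP.
assert (L : is_lim (fun b => (A + B) * Gam e b - B * Gam e t) p_infty
   ((A + B) * Gam_inf e - B * Gam e t)).
{ apply is_lim_minus'; [|apply is_lim_const].
  exact (is_lim_scal_l (Gam e) (A + B) p_infty (Gam_inf e) (Gam_inf_lim e (ek k))). }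
destruct (L P HP) as [M HM].
(* M comes from the limit of the integrals; b must also exceed t for the interval to split there. *)
exists (fun x => x = 0) (fun b => Rmax M t < b); [easy|exists (Rmax M t); easy|].
intros x b -> Hb; simpl.
assert (Hb1 : M < b) by (apply Rle_lt_trans with (2 := Hb), Rmax_l).
assert (Hb2 : t < b) by (apply Rle_lt_trans with (2 := Hb), Rmax_r).
exists ((A + B) * Gam e b - B * Gam e t); split; [|now apply HM].
replace ((A + B) * Gam e b - B * Gam e t)
  with (plus (scal A (RInt (gam e) 0 t)) (scal (A + B) (RInt (gam e) t b))).
- apply (is_RInt_Chasles (V := R_NormedModule)) with t.
  (* Only the open interval matters, so the differing values of [weight] and [gam] at 0 do no
     harm. *)
  + apply (is_RInt_ext (V := R_NormedModule)) with (fun x => scal A (gam e x)).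
    * intros x Hx; rewrite Rmin_left, Rmax_right in Hx by lra.
      unfold weight, theta, e; rewrite gam_pow, gam_pos by lra.
      destruct (Rlt_dec 0 (x - t)); [lra|]. unfold scal; simpl; unfold mult; simpl; ring.
    * apply (is_RInt_scal (V := R_NormedModule)), (RInt_correct (V := R_CompleteNormedModule)).
      apply ex_RInt_gam, ek.
  + apply (is_RInt_ext (V := R_NormedModule)) with (fun x => scal (A + B) (gam e x)).
    * intros x Hx; rewrite Rmin_left, Rmax_right in Hx by lra.
      unfold weight, theta, e; rewrite gam_pow, gam_pos by lra.
      destruct (Rlt_dec 0 (x - t)); [|lra]. unfold scal; simpl; unfold mult; simpl; ring.
    * apply (is_RInt_scal (V := R_NormedModule)), (RInt_correct (V := R_CompleteNormedModule)).
      apply ex_RInt_gam, ek.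
- unfold plus, scal; simpl; unfold mult; simpl.
  assert (C := RInt_Chasles (gam e) 0 t b (ex_RInt_gam _ _ _ (ek k)) (ex_RInt_gam _ _ _ (ek k))).
  unfold plus in C; simpl in C; unfold Gam; fold e in C; rewrite <- C; ring.
Qed.

End Moments.

(* These imports redefine notations of the final statement, so they are confined to a section. *)
Section HankelDeterminants.

Import all_boot all_order all_algebra perm Rstruct.
Import Order.TTheory GRing.Theory Num.Theory.
Local Open Scope R_scope.

(** * Leading minors and Jacobi's identity *)

Section Minors.
Local Open Scope ring_scope.
Variable F : fieldType.

(** Entries are indexed by all naturals, so one function yields minors of every size, and deleting a
    row or column is composition with [bump]. *)
Definition mindet n (f : nat -> nat -> F) := \det (\matrix_(i < n, j < n) f i j).

Lemma eq_mindet n f g :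
  (forall i j, (i < n)%N -> (j < n)%N -> f i j = g i j) -> mindet n f = mindet n g.
Proof. by move=> E; congr (\det _); apply/matrixP => i j; rewrite !mxE E. Qed.

Lemma mindet_tr n f : mindet n f = mindet n (fun i j => f j i).
Proof. by rewrite /mindet -det_tr; congr (\det _); apply/matrixP => i j; rewrite !mxE. Qed.

Lemma mindet0 f : mindet 0 f = 1.
Proof. by rewrite /mindet det_mx00. Qed.

Lemma mindet1 f : mindet 1 f = f 0%N 0%N.
Proof. by rewrite /mindet det_mx11 mxE. Qed.

Lemma det_mx22 (M : 'M[F]_2) : \det M = M 0 0 * M 1 1 - M 0 1 * M 1 0.
Proof.
rewrite (expand_det_row _ 0) !big_ord_recl big_ord0 addr0 /cofactor !det_mx11 !mxE /=.
have -> : (-1) ^+ (0 + 0) = 1 :> F by [].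
have -> : (-1) ^+ (0 + bump 0 0) = -1 :> F by [].
rewrite mul1r mulN1r mulrN.
have -> : lift ord0 ord0 = 1 :> 'I_2 by apply: val_inj.
by rewrite (_ : lift (1 : 'I_2) (0 : 'I_1) = 0) //; apply: val_inj.
Qed.

Lemma mindet_cofactor n (f : nat -> nat -> F) (i j : 'I_n) :
  cofactor (\matrix_(k < n, l < n) f k l) i j =
  (-1) ^+ (i + j) * mindet n.-1 (fun k l => f (bump i k) (bump j l)).
Proof. by congr (_ * \det _); apply/matrixP => k l; rewrite !mxE. Qed.

(* Jacobi's identity for the complementary minor, read off
   [M *m block_mx 1 B' 0 E' = block_mx A 0 C (\det M)%:M] where the last columns are those of [\adj M]. *)
Lemma det_drsub_adj m k (M : 'M[F]_(m + k)) : \det M != 0 ->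
  \det M * \det (drsubmx (\adj M)) = \det (ulsubmx M) * \det M ^+ k.
Proof.
move=> M0.
have E : M *m block_mx 1%:M (ursubmx (\adj M)) 0 (drsubmx (\adj M)) =
   block_mx (ulsubmx M) 0 (dlsubmx M) (\det M)%:M.
  have := mul_mx_adj M.
  rewrite -{1}(submxK M) -{1}(submxK (\adj M)) mulmx_block scalar_mx_block.
  move=> /eq_block_mx [_ E1 _ E2].
  by rewrite -{1}(submxK M) mulmx_block E1 E2 !mulmx1 !mulmx0 !addr0.
by have := congr1 determinant E; rewrite det_mulmx det_ublock det_lblock det1 mul1r det_scalar.
Qed.

(** The case k = 2 of [det_drsub_adj]: the 2 x 2 block of the adjugate holds the cofactors of the
    last two rows and columns, and one factor \det M cancels. *)
Lemma desnanot_jacobi m f : mindet m.+2 f != 0 ->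
  mindet m f * mindet m.+2 f =
  mindet m.+1 f * mindet m.+1 (fun i j => f (bump m i) (bump m j))
  - mindet m.+1 (fun i j => f (bump m i) j) * mindet m.+1 (fun i j => f i (bump m j)).
Proof.
have E2 : (m + 2 = m.+2)%N by rewrite addn2.
have E1 : ((m + 2).-1 = m.+1)%N by rewrite addn2.
rewrite -E2 => M0.
apply: (mulIf M0); rewrite -mulrA -expr2.
set M := \matrix_(i < m + 2, j < m + 2) f i j.
have -> : mindet m f = \det (ulsubmx M).
  by congr (\det _); apply/matrixP => i j; rewrite !mxE.
have := @det_drsub_adj m 2 M M0; rewrite -/(mindet (m + 2) f) -/M => <-.
rewrite mulrC; congr (_ * _); rewrite det_mx22 !mxE !mindet_cofactor E1 /=.
(* [bump (m + 1)] is the identity on indices up to m: deleting the last row or column renumbers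
   nothing. *)
have bumpl g : mindet m.+1 (fun i j => g (bump (m + 1) i) j) = mindet m.+1 g.
  by apply: eq_mindet => i j li lj; rewrite addn1 /bump leqNgt li.
have bumpr g : mindet m.+1 (fun i j => g i (bump (m + 1) j)) = mindet m.+1 g.
  by apply: eq_mindet => i j li lj; rewrite addn1 /bump leqNgt lj.
rewrite modn_small // !addn0.
rewrite (bumpl (fun i j => f i (bump (m + 1) j))) bumpr.
rewrite (bumpl (fun i j => f i (bump m j))) (bumpr (fun i j => f (bump m i) j)).
have ee : (-1) ^+ m * (-1) ^+ m = 1 :> F by rewrite -expr2 sqrr_sign.
rewrite !exprD expr1 !mulrN1 !mulNr !mulrN ee ?opprK !mul1r ?mulN1r ?mulNr ?mulrN ?opprK.
by rewrite mulrC; congr (_ - _); rewrite mulrC.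
Qed.

End Minors.
Arguments mindet {F} n f.


(** * Positivity of leading minors *)

Section Positivity.
Local Open Scope ring_scope.
Variables (F : realFieldType) (f : nat -> nat -> F).

(* The last column [v] of the adjugate of [M] satisfies [M v = \det M e_m], so its quadratic form is the
   product of two consecutive leading minors. *)
Lemma mindet_gt0 n :
  (forall n (p : {poly F}), p != 0 -> (size p <= n)%N ->
     0 < \sum_(i < n) \sum_(j < n) p`_i * p`_j * f i j) ->
  0 < mindet n f.
Proof.
move=> fpos; elim: n => [|n IHn]; first by rewrite mindet0.
set M := \matrix_(i < n.+1, j < n.+1) f i j.
pose v i : F := \adj M (inord i) ord_max.
have vn : v n = mindet n f.
  rewrite /v (_ : inord n = ord_max); last by apply: val_inj; rewrite /= inordK.
  rewrite mxE /cofactor exprD -expr2 sqrr_sign mul1r.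
  congr (\det _); apply/matrixP => i j; rewrite !mxE /=.
  by rewrite /bump (leqNgt n i) (leqNgt n j) !ltn_ord /= !add0n.
(* The coefficient of degree n is the minor of order n, so the induction hypothesis makes [p]
   nonzero. *)
pose p := \poly_(i < n.+1) v i.
have pn : p`_n = mindet n f by rewrite coef_poly ltnSn.
have p0 : p != 0.
  by apply: contraTneq IHn => p0; rewrite -pn p0 coef0 ltxx.
have := fpos n.+1 p p0 (size_poly _ _).
suff -> : \sum_(i < n.+1) \sum_(j < n.+1) p`_i * p`_j * f i j = mindet n f * mindet n.+1 f.
  by rewrite pmulr_rgt0.
transitivity (\sum_(i < n.+1) v i * (M *m \adj M) i ord_max).
  apply: eq_bigr => i _; rewrite mxE mulr_sumr; apply: eq_bigr => j _.
  by rewrite !coef_poly !ltn_ord mxE /v !inord_val -mulrA; congr (_ * _); rewrite mulrC.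
rewrite (bigD1 ord_max) //= big1 ?addr0 => [|i /negPf ni]; rewrite mul_mx_adj mxE.
  by rewrite eqxx vn.
by rewrite ni mulr0.
Qed.

End Positivity.


(** * Derivatives of determinants *)

Section Derivatives.

Lemma is_derive_sum (I : Type) (r : seq I) (P : pred I) (f : I -> R -> R) (df : I -> R) s :
  (forall i, is_derive (f i) s (df i)) ->
  is_derive (fun x => (\sum_(i <- r | P i) f i x)%R) s (\sum_(i <- r | P i) df i)%R.
Proof.
move=> D; elim: r => [|i r IH].
  apply: (is_derive_ext (fun _ => 0)) => [x|]; rewrite ?big_nil //.
  exact: (is_derive_const (V := R_NormedModule)).
apply: (is_derive_ext (fun x => if P i then (f i x + \sum_(i <- r | P i) f i x)%R
                                else (\sum_(i <- r | P i) f i x)%R)).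
  by move=> x; rewrite big_cons.
rewrite big_cons; case: (P i) => //.
exact: (is_derive_plus (V := R_NormedModule)).
Qed.

Lemma is_derive_prod n (f : 'I_n -> R -> R) (df : 'I_n -> R) s :
  (forall i, is_derive (f i) s (df i)) ->
  is_derive (fun x => (\prod_(i < n) f i x)%R) s
    (\sum_(k < n) \prod_(i < n) (if i == k then df i else f i s))%R.
Proof.
elim: n f df => [|n IH] f df D.
  rewrite big_ord0; apply: (is_derive_ext (fun _ => 1)) => [x|]; rewrite ?big_ord0 //.
  exact: (is_derive_const (V := R_NormedModule)).
apply: (is_derive_ext (fun x => f ord0 x * (\prod_(i < n) f (lift ord0 i) x)%R)).
  by move=> x; rewrite big_ord_recl.
rewrite big_ord_recl big_ord_recl eqxx.
have E := IH (fun i => f (lift ord0 i)) (fun i => df (lift ord0 i)) (fun i => D _).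
have -> : (\sum_(i < n) \prod_(i0 < n.+1) (if i0 == lift ord0 i then df i0 else f i0 s) =
   f ord0 s * \sum_(k < n) \prod_(i < n) (if i == k then df (lift ord0 i) else f (lift ord0 i) s))%R.
  rewrite mulr_sumr; apply: eq_bigr => k _; rewrite big_ord_recl /=; congr (_ * _)%R.
exact: (is_derive_mult (f ord0) _ s _ _ (D ord0) E Rmult_comm).
Qed.

(** Replacing row k by minus row k + 1 creates two proportional rows unless k is the last row, so a
    single term of the Leibniz rule survives. The right-hand side has the form that [is_derive_prod]
    produces. *)
Lemma mindet_shift_sum (F : fieldType) m (g : nat -> nat -> F) :
  (- mindet m.+1 (fun i j => g (bump m i) j) =
   \sum_(sigma : 'S_m.+1) (-1) ^+ sigma *
     \sum_(k < m.+1) \prod_(i < m.+1) (if i == k then - g i.+1 (sigma i) else g i (sigma i)))%R.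
Proof.
transitivity (- \sum_(k < m.+1)
    \det (\matrix_(i < m.+1, j < m.+1) if i == k then g i.+1 j else g i j))%R.
  congr (- _)%R; rewrite big_ord_recr /= big1 ?add0r => [|k _].
    congr (\det _)%R; apply/matrixP => i j; rewrite !mxE -val_eqE /= /bump.
    case: eqP => [->|/eqP ni]; first by rewrite leqnn.
    by rewrite leqNgt ltn_neqAle ni -ltnS ltn_ord.
  have kS : widen_ord (leqnSn m) k != lift ord0 k by rewrite -val_eqE /= /bump /= neq_ltn ltnSn.
  rewrite (determinant_alternate kS) // => j; rewrite !mxE eqxx eq_sym (negPf kS).
  by rewrite /= /bump.
rewrite -sumrN; under [RHS]eq_bigr do rewrite mulr_sumr.
rewrite exchange_big; apply: eq_bigr => k _; rewrite /determinant -sumrN.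
apply: eq_bigr => sigma _; rewrite -mulrN; congr (_ * _)%R.
rewrite (bigD1 k) //= [RHS](bigD1 k) //= !mxE eqxx mulNr; congr (- (_ * _))%R.
by apply: eq_bigr => i /negPf ni; rewrite mxE ni.
Qed.

Lemma mindet_derive m (g : nat -> nat -> R -> R) s :
  (forall i j, is_derive (g i j) s (- g i.+1 j s)) ->
  is_derive (fun x => mindet m.+1 (fun i j => g i j x)) s
    (- mindet m.+1 (fun i j => g (bump m i) j s)).
Proof.
move=> D.
pose sg (sigma : 'S_m.+1) : R := ((-1) ^+ sigma)%R.
apply: (is_derive_ext (fun x => (\sum_(sigma : 'S_m.+1) sg sigma * \prod_(i < m.+1) g i (sigma i) x)%R)).
  move=> x; rewrite /mindet /determinant; apply: eq_bigr => sigma _; congr (_ * _)%R.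
  by apply: eq_bigr => i _; rewrite mxE.
rewrite RoppE (mindet_shift_sum _ m (fun i j => g i j s)).
exact: is_derive_sum (fun sigma : 'S_m.+1 =>
  is_derive_scal _ s (sg sigma) _ (is_derive_prod _ _ _ s (fun i : 'I_m.+1 => D i (sigma i)))).
Qed.

End Derivatives.

(** * Scaling of determinants, limits of sums, roots of polynomials *)

Lemma mindet_scale (F : fieldType) n (c d : nat -> F) f :
  (mindet n (fun i j => c i * d j * f i j) =
   (\prod_(i < n) (c i * d i)) * mindet n f)%R.
Proof.
rewrite big_split /= /mindet.
have -> : (\matrix_(i < n, j < n) (c i * d j * f i j) =
   diag_mx (\row_(i < n) c i) *m (\matrix_(i < n, j < n) f i j) *m diag_mx (\row_(i < n) d i))%R.
  apply/matrixP => i j; rewrite mul_mx_diag mul_diag_mx !mxE.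
  by rewrite -!mulrA; congr (_ * _)%R; rewrite mulrC.
rewrite !det_mulmx !det_diag -mulrA mulrCA mulrC; congr (_ * _ * _)%R.
- by apply: eq_bigr => i _; rewrite mxE.
- by apply: eq_bigr => i _; rewrite mxE.
Qed.

Lemma is_lim_sum (I : Type) (r : seq I) (f : I -> R -> R) (l : I -> R) x :
  (forall i, is_lim (f i) x (l i)) ->
  is_lim (fun y => (\sum_(i <- r) f i y)%R) x (\sum_(i <- r) l i)%R.
Proof.
move=> L; elim: r => [|i r IH].
  rewrite big_nil; apply: (is_lim_ext (fun _ => 0)) => [y|]; rewrite ?big_nil //.
  exact: is_lim_const.
rewrite big_cons; apply: (is_lim_ext (fun y => f i y + (\sum_(i <- r) f i y)%R)).
  by move=> y; rewrite big_cons.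
exact: is_lim_plus'.
Qed.

Lemma poly_roots_half_line (p : {poly R}) t :
  (forall x, t < x -> p.[x]%R = 0) -> p = 0%R.
Proof.
move=> H; apply/eqP/negPn/negP => p0.
(* The points t + 1, ..., t + size p are more roots than the degree allows. *)
pose rs := [seq t + INR k.+1 | k <- iota 0 (size p)].
have : (size rs < size p)%N.
  apply: max_poly_roots => //.
    apply/allP => _ /mapP [k _ ->]; apply/eqP; apply: H.
    by have := lt_0_INR k.+1 (Nat.lt_0_succ k); lra.
  rewrite map_inj_uniq ?iota_uniq // => i j /Rplus_eq_reg_l /INR_eq.
  by case.
by rewrite size_map size_iota ltnn.
Qed.

(** The exponents 2 i + a + 1 for i < n add up to n (n + a). *)
Lemma prod_Rpower n s a :
  (\prod_(i < n) (Rpower s (INR i) * Rpower s (INR i + a + 1)))%R =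
  Rpower s (INR n * (INR n + a)).
Proof.
elim: n => [|n IH]; first by rewrite big_ord0 Rmult_0_l /Rpower Rmult_0_l exp_0.
rewrite S_INR big_ord_recr /= IH -!RmultE -!Rpower_plus; congr Rpower; ring.
Qed.

(** * The Hankel determinants of the jump weight *)

Section Hankel.

Variables (alpha A B : R).
Hypotheses (alpha_pos : 0 < alpha) (A_ge0 : 0 <= A) (B_pos : 0 < B).

(** With Q(b) the integral of p^2 x^alpha e^(-x) over [0, b], the form equals A Q(oo) + B (Q(oo) -
    Q(t)). Since Q is nondecreasing, Q(t) = Q(oo) would make it constant beyond t, forcing p to
    vanish there. *)
Lemma moment_quadratic_pos n (p : {poly R}) t : 0 < t -> p != 0%R -> (size p <= n)%N ->
  0 < (\sum_(i < n) \sum_(j < n) p`_i * p`_j * moment alpha A B (i + j) t)%R.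
Proof.
move=> t0 p0 sp.
have ek k : 0 < alpha + INR k by have := pos_INR k; lra.
(* Taking f to be [gam] at x, [Gam] at x, or [Gam_inf] gives Q'(x), Q(x) and Q(oo). *)
pose quad (f : R -> R) := (\sum_(i < n) \sum_(j < n) p`_i * p`_j * f (alpha + INR (i + j)%N))%R.
have DS x : is_derive (fun x => quad (fun e => Gam e x)) x (quad (fun e => gam e x)).
  apply: is_derive_sum => i; apply: is_derive_sum => j.
  exact/is_derive_scal/Gam_derive.
have LS : is_lim (fun x => quad (fun e => Gam e x)) p_infty (quad Gam_inf).
  apply: is_lim_sum => i; apply: is_lim_sum => j.
  apply: (is_lim_scal_l _ _ p_infty (Gam_inf (alpha + INR (i + j)%N))); exact: Gam_inf_lim.
have gS x : quad (fun e => gam e x) = p.[x]%R ^ 2 * gam alpha x.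
  have -> : p.[x]%R ^ 2 * gam alpha x = (p.[x] * p.[x] * gam alpha x)%R by rewrite -!RmultE; ring.
  rewrite /quad (horner_coef_wide x sp) big_distrlr /= mulr_suml; apply: eq_bigr => i _.
  rewrite mulr_suml; apply: eq_bigr => j _.
  rewrite gam_pow -!RpowE pow_add -!RmultE; move: (p`_i)%R (p`_j)%R (gam alpha x) => a b c; ring.
have gS0 x : 0 <= quad (fun e => gam e x).
  by rewrite gS; apply: Rmult_le_pos; [apply: pow2_ge_0 | apply: gam_ge0].
have incr a b : a <= b -> quad (fun e => Gam e a) <= quad (fun e => Gam e b).
  by apply: (derive_ge0_incr (fun x => quad (fun e => Gam e x)) (fun x => quad (fun e => gam e x))).
have leinf a : quad (fun e => Gam e a) <= quad Gam_inf.
  apply: (is_lim_le_loc (fun _ => quad (fun e => Gam e a)) (fun x => quad (fun e => Gam e x))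
    p_infty _ _ _ (is_lim_const _ _) LS).
  by exists a => x ax; apply: incr; lra.
have S0 : quad (fun e => Gam e 0) = 0.
  by rewrite /quad big1 // => i _; rewrite big1 // => j _; rewrite Gam0 mulr0.
have lt : quad (fun e => Gam e t) < quad Gam_inf.
  case: (leinf t) => // E; exfalso; move/eqP: p0; apply.
  apply: (poly_roots_half_line _ t) => x tx.
  have cst y : t < y -> quad (fun e => Gam e y) = quad Gam_inf.
    by move=> ty; have := leinf y; have := incr t y (Rlt_le _ _ ty); lra.
  have Dx : is_derive (fun x => quad (fun e => Gam e x)) x 0.
    apply: (is_derive_ext_gt (fun _ => quad Gam_inf) _ t) => //; first by move=> y ty; rewrite cst.
    exact: (is_derive_const (V := R_NormedModule)).
  have gx : 0 < gam alpha x.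
    by rewrite gam_pos; [apply: Rmult_lt_0_compat; apply: exp_pos | lra].
  have := is_derive_unique _ _ _ Dx; rewrite (is_derive_unique _ _ _ (DS x)) gS.
  case/Rmult_integral; last by lra.
  by move=> H; apply: Rsqr_0_uniq; rewrite /Rsqr -H /=; ring.
have -> : (\sum_(i < n) \sum_(j < n) p`_i * p`_j * moment alpha A B (i + j) t)%R =
   (A + B) * quad Gam_inf - B * quad (fun e => Gam e t).
  have lin a b x y : a * b * ((A + B) * x - B * y) = (A + B) * (a * b * x) - B * (a * b * y) by ring.
  rewrite /quad RminusE !RmultE !mulr_sumr -sumrB; apply: eq_bigr => i _.
  rewrite !mulr_sumr -sumrB; apply: eq_bigr => j _.
  rewrite moment_eq //; exact: lin.
have := leinf 0; rewrite S0 => Sge.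
have -> : (A + B) * quad Gam_inf - B * quad (fun e => Gam e t) =
  A * quad Gam_inf + B * (quad Gam_inf - quad (fun e => Gam e t)) by ring.
by apply: Rplus_le_lt_0_compat; [apply: Rmult_le_pos | apply: Rmult_lt_0_compat; lra].
Qed.

Lemma Dn_pos n t : 0 < t -> 0 < Dn alpha A B n t.
Proof.
move=> t0; apply/RltP; apply: (mindet_gt0 _ (fun i j => moment alpha A B (i + j) t)).
by move=> m p p0 sp; apply/RltP; apply: moment_quadratic_pos.
Qed.

(** By x = s y these are the moments of y^alpha e^(-s y) (A + B theta (y - 1)), whose jump stays at
    1 as s varies. *)
Definition nu k s := moment alpha A B k s / Rpower s (INR k + alpha + 1).
Definition tau n s := mindet n (fun i j => nu (i + j) s).
(* On indices up to m, bump m replaces m by m + 1 and fixes the others. *)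
Definition dtau n s :=
  if n is m.+1 then - mindet n (fun i j => nu (bump m i + j) s) else 0.
Definition ddtau n s :=
  if n is m.+1 then mindet n (fun i j => nu (bump m i + bump m j) s) else 0.

Lemma moment_nu k s : moment alpha A B k s = Rpower s (INR k + alpha + 1) * nu k s.
Proof. by rewrite /nu; field; apply: Rgt_not_eq; exact: exp_pos. Qed.

(** The power s^(i + j + alpha + 1) splits into a row factor and a column factor. *)
Lemma Dn_tau n s : 0 < s -> Dn alpha A B n s = Rpower s (INR n * (INR n + alpha)) * tau n s.
Proof.
move=> s0; rewrite -prod_Rpower RmultE.
change (mindet n (fun i j => moment alpha A B (i + j)%N s) =
  (\prod_(i < n) (Rpower s (INR i) * Rpower s (INR i + alpha + 1)) * tau n s)%R).
rewrite -(mindet_scale _ n (fun i => Rpower s (INR i)) (fun i => Rpower s (INR i + alpha + 1))).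
apply: eq_mindet => i j _ _; rewrite -!RmultE -Rpower_plus moment_nu plus_INR.
by congr (Rpower _ _ * _); ring.
Qed.

Lemma tau_pos n s : 0 < s -> 0 < tau n s.
Proof.
move=> s0; have := Dn_pos n s s0; rewrite Dn_tau // => H.
apply: (Rmult_lt_reg_l (Rpower s (INR n * (INR n + alpha)))); first exact: exp_pos.
by rewrite Rmult_0_r.
Qed.

(** Integration by parts, with a boundary term from the jump at s. *)
Lemma moment_rec k s : 0 < s ->
  moment alpha A B k.+1 s =
  (INR k + alpha + 1) * moment alpha A B k s + B * (Rpower s (INR k + alpha + 1) * exp (- s)).
Proof.
move=> s0; rewrite !moment_eq // S_INR.
have ek : 0 < alpha + INR k by have := pos_INR k; lra.
have -> : alpha + (INR k + 1) = alpha + INR k + 1 by ring.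
rewrite Gam_inf_rec // Gam_rec //; last lra.
rewrite gam_pos //; have -> : INR k + alpha + 1 = alpha + INR k + 1 by ring.
ring.
Qed.

Lemma nu_rec k s : 0 < s ->
  s * nu k.+1 s = (INR k + alpha + 1) * nu k s + B * exp (- s).
Proof.
move=> s0; rewrite /nu moment_rec // S_INR.
have -> : INR k + 1 + alpha + 1 = INR k + alpha + 1 + 1 by ring.
rewrite (Rpower_plus (INR k + alpha + 1) 1) Rpower_1 //.
have := exp_pos ((INR k + alpha + 1) * ln s); rewrite -/(Rpower s _) => P.
field; lra.
Qed.

(** The moment depends on s only through the position of the jump, so its derivative is - B s^(k +
    alpha) e^(-s); the quotient rule and [nu_rec] then give the claim. *)
Lemma nu_derive k s : 0 < s -> is_derive (nu k) s (- nu k.+1 s).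
Proof.
move=> s0.
have ek : 0 < alpha + INR k by have := pos_INR k; lra.
have Dm : is_derive (moment alpha A B k) s (- (B * gam (alpha + INR k) s)).
  apply: (is_derive_ext_gt (fun s => (A + B) * Gam_inf (alpha + INR k) - B * Gam (alpha + INR k) s)
    _ 0) => //.
    by move=> y y0; rewrite moment_eq.
  have D := Gam_derive _ s ek.
  auto_derive; [by exists (gam (alpha + INR k) s)|].
  derive_rw D; ring.
have Dp : is_derive (fun s => Rpower s (INR k + alpha + 1)) s
   ((INR k + alpha + 1) / s * Rpower s (INR k + alpha + 1)).
  rewrite /Rpower; auto_derive => //; field; lra.
have P : Rpower s (INR k + alpha + 1) <> 0 by apply: Rgt_not_eq; exact: exp_pos.
have -> : - nu k.+1 s = (- (B * gam (alpha + INR k) s) * Rpower s (INR k + alpha + 1) -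
   moment alpha A B k s * ((INR k + alpha + 1) / s * Rpower s (INR k + alpha + 1)))
   / Rpower s (INR k + alpha + 1) ^ 2.
  have -> : nu k.+1 s = ((INR k + alpha + 1) * nu k s + B * exp (- s)) / s.
    rewrite -nu_rec //; field; lra.
  rewrite /nu.
  have -> : Rpower s (INR k + alpha + 1) = Rpower s (alpha + INR k) * s.
    by rewrite Rpower_plus Rpower_1 // (Rplus_comm alpha).
  rewrite gam_pos //.
  have := exp_pos ((alpha + INR k) * ln s); rewrite -/(Rpower s _) => P'.
  field; lra.
exact: is_derive_div.
Qed.

Lemma tau_derive n s : 0 < s -> is_derive (tau n) s (dtau n s).
Proof.
move=> s0; case: n => [|m].
  apply: (is_derive_ext (fun _ => 1)) => [x|]; first by rewrite /tau mindet0.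
  exact: (is_derive_const (V := R_NormedModule)).
apply: (mindet_derive m (fun i j => nu (i + j))) => i j.
exact: nu_derive.
Qed.

(** The shifted last row breaks the consecutive order of the rows, but the columns are still
    consecutive. After transposition [mindet_derive] applies again and shifts the last column. *)
Lemma dtau_derive n s : 0 < s -> is_derive (dtau n) s (ddtau n s).
Proof.
move=> s0; case: n => [|m]; first exact: (is_derive_const (V := R_NormedModule)).
rewrite -[ddtau _ _]Ropp_involutive.
apply: (is_derive_opp (V := R_NormedModule) (fun s => mindet m.+1 (fun i j => nu (bump m i + j) s))).
rewrite /ddtau mindet_tr.
apply: (is_derive_ext (fun s => mindet m.+1 (fun i j => nu (i + bump m j) s))) => [x|].
  by rewrite mindet_tr; apply: eq_mindet => i j _ _; rewrite addnC.
have -> : mindet m.+1 (fun i j => nu (bump m j + bump m i) s) =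
    mindet m.+1 (fun i j => nu (bump m i + bump m j) s).
  by apply: eq_mindet => i j _ _; rewrite addnC.
apply: (mindet_derive m (fun i j => nu (i + bump m j))) => i j.
exact: nu_derive.
Qed.

(** In Jacobi's identity the minors with shifted last row and with shifted last column agree by the
    symmetry of a Hankel matrix, and both equal - dtau_(n+1). *)
Lemma tau_toda n s : 0 < s ->
  tau n s * tau n.+2 s = tau n.+1 s * ddtau n.+1 s - dtau n.+1 s ^ 2.
Proof.
move=> s0; rewrite /dtau /= Rmult_1_r Rmult_opp_opp.
have N : mindet n.+2 (fun i j => nu (i + j) s) != 0%R.
  by apply/eqP/Rgt_not_eq/tau_pos.
rewrite {1}/tau RmultE (desnanot_jacobi _ n _ N).
rewrite [X in (_ - _ * X)%R]mindet_tr; congr (_ - _ * _)%R.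
by apply: eq_mindet => i j _ _; rewrite addnC.
Qed.

Lemma tau0 s : tau 0 s = 1.
Proof. exact: mindet0. Qed.

Lemma tau_base s : 0 < s -> - (s * dtau 1 s) = (1 + alpha) * tau 1 s + B * exp (- s).
Proof.
move=> s0; rewrite /dtau /tau !mindet1 /=.
have := nu_rec 0 s s0; rewrite /= => E.
change (- (s * - nu 1 s) = (1 + alpha) * nu 0 s + B * exp (- s)).
rewrite -Ropp_mult_distr_r Ropp_involutive E; ring.
Qed.

Lemma Hn_eq n s : 0 < s ->
  Hn alpha A B n s = INR n * (INR n + alpha) + s * dlog tau dtau n s.
Proof.
move=> s0; rewrite /Hn.
have N := tau_pos n s s0; have D := tau_derive n s s0.
rewrite (is_derive_unique _ _ (INR n * (INR n + alpha) / s + dtau n s / tau n s)).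
  rewrite /dlog; field; lra.
apply: (is_derive_ext_gt (fun s => INR n * (INR n + alpha) * ln s + ln (tau n s)) _ 0) => //.
  move=> y y0; rewrite Dn_tau // ln_mult ?ln_exp //; [exact: exp_pos | exact: tau_pos].
auto_derive; [by repeat split => //; exists (dtau n s)|].
derive_rw D; field; lra.
Qed.

End Hankel.

End HankelDeterminants.

Theorem theorem6 (alpha A B t : R) (n : nat) :
  0 < alpha -> 0 <= A -> 0 < B -> 0 < t -> (1 <= n)%nat ->
  let H := Hn alpha A B n in
  let H1 := Derive H t in
  let H2 := Derive (Derive H) t in
  (t * H2) ^ 2 =
    4 * H1 ^ 2 * (H t - INR n * (INR n + alpha) - t * H1)
    + ((2 * INR n + alpha - t) * H1 + H t) ^ 2.
Proof.
intros Halpha HA HB Ht _ H.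
apply (sigma_form alpha B (tau alpha A B) (dtau alpha A B) (ddtau alpha A B)).
all: auto using tau_pos, tau_derive, dtau_derive, tau_toda, tau_base, tau0.
intros s Hs; now apply Hn_eq.
Qed.
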